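(* Let $G^v$ and $H^w$ be finite simple rooted graphs. For any fixed nonnegative integer $k$, the sequence of independence polynomials $\bigl(I((G^v:H^w)_k^{(m)};x)\bigr)_{m\geq 0}$ satisfies a linear recurrence whose characteristic polynomial is \[ \chi(r) = \bigl(r - I(H;x)^k\bigr)\bigl(r - I(Z_k(H^w);x)\bigr). \]
   Context: All graphs are finite and simple. The independence polynomial of a graph $G$ is $I(G;x)=\sum_{i\ge 0} s_i x^i$, where $s_i$ is the number of independent sets of size $i$. A rooted graph $G^v$ is a graph with a distinguished vertex $v$. For a rooted graph $H^w$ and integer $k\ge 0$, the scale graph $Z_k(H^w)$ is obtained by taking a new vertex $v_0$ and $k$ disjoint copies of $H$ and joining $v_0$ to the root $w$ of each copy. For disjoint rooted graphs $G^v,H^w$, $(G^v:H^w)_k$ is the disjoint union of $G$ and $Z_k(H^w)$ plus the edge $vv_0$, rooted at $v$. For a sequence of nonnegative integers $i_1,\dots,i_j$, define recursively $(G^v:H^w)_{i_1,\ldots,i_j}=((G^v:H^w)_{i_1,\ldots,i_{j-1}}^v:H^w)_{i_j}$ (the empty sequence giving $G^v$), and $(G^v:H^w)_k^{(m)}=(G^v:H^w)_{k,\ldots,k}$ with $k$ repeated $m$ times. A sequence $(p_m)_{m\ge0}$ satisfies the linear recurrence with characteristic polynomial $r^n - c_{n-1}r^{n-1}-\cdots-c_0$ if $p_m = c_{n-1}p_{m-1}+\cdots+c_0p_{m-n}$ for all $m\ge n$. *)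

(* Defs.v *)
From HB Require Import structures.
From mathcomp Require Import all_boot all_order all_algebra.

Set Implicit Arguments.
Unset Strict Implicit.
Unset Printing Implicit Defensive.

Import GRing.Theory.
Local Open Scope ring_scope.

Record simple_graph := SimpleGraph {
  vertex :> finType;
  adj : rel vertex;
  adj_sym : symmetric adj;
  adj_irr : irreflexive adj }.

Record rooted_graph := RootedGraph {
  graph_of :> simple_graph;
  root_of : graph_of }.

Definition independent (G : simple_graph) (S : {set G}) : bool :=
  [forall x in S, forall y in S, ~~ adj x y].

Definition num_indep (G : simple_graph) (i : nat) : nat :=
  #|[set S : {set G} | independent S & #|S| == i]|.

(* No independent set has more than #|G| elements, so the sum stops there. *)
Definition indep_poly (G : simple_graph) : {poly int} :=
  \sum_(i < #|G|.+1) (num_indep G i)%:R *: 'X^i.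

Section Scale.
Variables (k : nat) (H : rooted_graph).

(* None is the new vertex v_0, and Some (i, x) is the vertex x of the i-th
   copy of H. *)
Definition scale_adj : rel (option ('I_k * H)) := fun a b =>
  match a, b with
  | None, None => false
  | None, Some (_, y) => y == root_of H
  | Some (_, x), None => x == root_of H
  | Some (i, x), Some (j, y) => (i == j) && adj x y
  end.

Lemma scale_adj_sym : symmetric scale_adj.
Proof. by move=> [[i x]|] [[j y]|] //=; rewrite eq_sym adj_sym. Qed.

Lemma scale_adj_irr : irreflexive scale_adj.
Proof. by move=> [[i x]|] //=; rewrite adj_irr andbF. Qed.

Definition scale_graph : simple_graph := SimpleGraph scale_adj_sym scale_adj_irr.

Definition scale_center : scale_graph := None.

End Scale.

Section Attach.
Variables (G H : rooted_graph) (k : nat).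

Definition attach_adj : rel (G + scale_graph k H)%type := fun a b =>
  match a, b with
  | inl x, inl y => adj x y
  | inr x, inr y => adj x y
  | inl x, inr y | inr y, inl x =>
      (x == root_of G) && (y == scale_center k H)
  end.

Lemma attach_adj_sym : symmetric attach_adj.
Proof. by move=> [x|x] [y|y] //=; [exact: adj_sym|exact: scale_adj_sym]. Qed.

Lemma attach_adj_irr : irreflexive attach_adj.
Proof. by move=> [x|x] /=; [exact: adj_irr|exact: scale_adj_irr]. Qed.

(* The rooted graph (G^v : H^w)_k *)
Definition attach : rooted_graph :=
  @RootedGraph (SimpleGraph attach_adj_sym attach_adj_irr) (inl (root_of G)).

End Attach.

(* (G^v : H^w)_{i_1,...,i_j}: foldl attaches i_1 first and i_j last. *)
Definition attach_seq (G H : rooted_graph) (s : seq nat) : rooted_graph :=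
  foldl (fun G' i => attach G' H i) G s.

Definition attach_iter (G H : rooted_graph) (k m : nat) : rooted_graph :=
  attach_seq G H (nseq m k).

(* chi = 'X^n - c_{n-1} 'X^(n-1) - ... - c_0, so chi is monic and c_i is
   - chi`_i; the index m - n + i below is a genuine subtraction since
   n <= m. *)
Definition satisfies_recurrence (R : nzRingType) (p : nat -> R)
    (chi : {poly R}) : Prop :=
  chi \is monic /\
  forall m : nat, let n := (size chi).-1 in (n <= m)%N ->
    p m = \sum_(i < n) (- chi`_i) * p (m - n + i)%N.

(* Main.v *)
Require Import Defs.
From mathcomp Require Import all_boot all_order all_algebra.
From mathcomp Require Import ring.
Import GRing.Theory.
Local Open Scope ring_scope.

(** The sets counted by [I((G^v : H^w)_k)] are the pairs of an independent set
    of [G] and one of [Z_k(H^w)] that do not contain [v] and [v_0] at the same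
    time. Split [I(G)] as [A + B], where [A] counts the sets avoiding [v] and
    [B] those containing it. Attaching a copy of [Z_k(H^w)] multiplies [A] by
    [I(Z_k(H^w))] and [B] by [I(H)^k], since the independent sets of
    [Z_k(H^w)] avoiding [v_0] are the [k]-tuples of independent sets of [H].
    So the sequence is a combination of two geometric sequences whose ratios
    are the roots of the characteristic polynomial. *)

Definition indep_gf (G : simple_graph) (P : pred {set G}) : {poly int} :=
  \sum_(S : {set G} | independent S && P S) 'X^#|S|.

Lemma independentP (G : simple_graph) (S : {set G}) :
  reflect {in S &, forall x y, ~~ adj x y} (independent S).
Proof.
apply: (iffP 'forall_implyP) => [h x y xS yS | h x xS].
  by have /'forall_implyP := h x xS; apply.
by apply/'forall_implyP => y yS; apply: h.
Qed.

Lemma indep_poly_gf (G : simple_graph) : indep_poly G = indep_gf G xpredT.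
Proof.
rewrite /indep_poly /indep_gf.
(* Group the independent sets by size; [inord] loses nothing because [#|S|] is at most [#|G|]. *)
rewrite (partition_big (fun S : {set G} => inord #|S| : 'I_#|G|.+1) xpredT) //=.
apply: eq_bigr => i _; rewrite /num_indep.
have cardS (S : {set G}) : (inord #|S| == i :> 'I_#|G|.+1) = (#|S| == i).
  by rewrite -val_eqE /= inordK // ltnS max_card.
under eq_bigl => S do rewrite andbT cardS.
transitivity (
  \sum_(S : {set G} | independent S && (#|S| == i)) 'X^i : {poly int}).
  by rewrite sumr_const cardsE scaler_nat.
by apply: eq_bigr => S /andP[_ /eqP ->].
Qed.

Lemma indep_gf_split (G : simple_graph) (x : G) :
  indep_poly G = indep_gf G (fun S => x \notin S) + indep_gf G (fun S => x \in S).
Proof.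
rewrite indep_poly_gf /indep_gf (bigID (fun S : {set G} => x \notin S)) /=.
by congr (_ + _); apply: eq_bigl => S; rewrite andbT ?negbK.
Qed.

Section SumSets.
Variables T1 T2 : finType.

Definition sum_set (A : {set T1} * {set T2}) : {set T1 + T2} :=
  [set x | match x with inl a => a \in A.1 | inr b => b \in A.2 end].

Lemma sum_set_bij : bijective sum_set.
Proof.
exists (fun S : {set T1 + T2} => (inl @^-1: S, inr @^-1: S)) => [[A B]|S].
  by congr pair; apply/setP => x; rewrite !inE.
by apply/setP => -[x|x]; rewrite !inE.
Qed.

Lemma card_sum_set A : #|sum_set A| = (#|A.1| + #|A.2|)%N.
Proof.
rewrite -!sum1_card big_sumType /=.
by congr addn; apply: eq_bigl => x; rewrite inE.
Qed.

End SumSets.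

(** The only edge between the two summands is $vv_0$, which accounts for the last conjunct. *)
Lemma independent_sum_set (G H : rooted_graph) k
    (A : {set G} * {set scale_graph k H}) :
  independent (sum_set _ _ A : {set attach G H k}) =
  [&& independent A.1, independent A.2 &
      ~~ ((root_of G \in A.1) && (scale_center k H \in A.2))].
Proof.
apply/independentP/and3P => [ind | [/independentP ind1 /independentP ind2 nvv0]].
- split.
  + by apply/independentP => x y xA yA; apply: (ind (inl x) (inl y)); rewrite inE.
  + by apply/independentP => x y xA yA; apply: (ind (inr x) (inr y)); rewrite inE.
  + apply/negP => /andP[vA v0A].
    have := ind (inl (root_of G)) (inr (scale_center k H)).
    by rewrite !inE /= !eqxx => /(_ vA v0A).
- move=> [x|x] [y|y]; rewrite !inE /=.
  + exact: ind1.
  + by move=> xA yA; apply: contra nvv0 => /andP[/eqP <- /eqP <-]; rewrite xA.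
  + by move=> xA yA; apply: contra nvv0 => /andP[/eqP <- /eqP <-]; rewrite yA.
  + exact: ind2.
Qed.

(** Sizes add under the bijection [sum_set], so the sum factors once [P] decouples the constraint
    imposed by the edge $vv_0$; the hypothesis expresses this decoupling. *)
Lemma indep_gf_attach (G H : rooted_graph) k
    (P : pred {set attach G H k}) (P1 : pred {set G})
    (P2 : pred {set scale_graph k H}) :
  (forall (A : {set G}) (B : {set scale_graph k H}),
     (~~ ((root_of G \in A) && (scale_center k H \in B)) &&
      P (sum_set _ _ (A, B))) = P1 A && P2 B) ->
  indep_gf (attach G H k) P = indep_gf G P1 * indep_gf (scale_graph k H) P2.
Proof.
move=> PE; rewrite /indep_gf (reindex _ (onW_bij _ (sum_set_bij _ _))) /=.
rewrite big_distrlr pair_big /=; apply: eq_big => [[A B]|[A B] _] /=.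
  rewrite independent_sum_set /= -!andbA PE.
  by do 2!case: (independent _); rewrite ?andbF.
by rewrite -exprD card_sum_set.
Qed.

(** When $v$ is left out, the edge $vv_0$ imposes nothing on the part in $Z_k(H^w)$. *)
Lemma indep_gf_attach_notin (G H : rooted_graph) k :
  indep_gf (attach G H k) (fun S => root_of (attach G H k) \notin S) =
  indep_gf G (fun S => root_of G \notin S) * indep_poly (scale_graph k H).
Proof.
rewrite indep_poly_gf; apply: indep_gf_attach => A B.
by rewrite inE /= andbT; case: (_ \in A); rewrite ?andbF.
Qed.

(** When $v$ is chosen, the edge $vv_0$ amounts to excluding $v_0$. *)
Lemma indep_gf_attach_in (G H : rooted_graph) k :
  indep_gf (attach G H k) (fun S => root_of (attach G H k) \in S) =
  indep_gf G (fun S => root_of G \in S) *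
  indep_gf (scale_graph k H) (fun S => scale_center k H \notin S).
Proof.
apply: indep_gf_attach => A B.
by rewrite inE /= andbC; case: (_ \in A).
Qed.

Section CopySets.
Variables (k : nat) (T : finType).

Definition copies_set (f : {ffun 'I_k -> {set T}}) : {set option ('I_k * T)} :=
  [set a | if a is Some (i, x) then x \in f i else false].

Definition set_copies (S : {set option ('I_k * T)}) : {ffun 'I_k -> {set T}} :=
  [ffun i => [set x | Some (i, x) \in S]].

Lemma copies_setK : cancel copies_set set_copies.
Proof. by move=> f; apply/ffunP => i; apply/setP => x; rewrite ffunE !inE. Qed.

(** [set_copies] forgets whether [None] belongs to the set, so it inverts [copies_set] only on sets
    avoiding $v_0$. *)
Lemma set_copiesK (S : {set option ('I_k * T)}) :
  None \notin S -> copies_set (set_copies S) = S.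
Proof.
move=> NS; apply/setP => -[[i x]|]; rewrite !inE ?ffunE ?inE //.
by rewrite (negPf NS).
Qed.

Lemma card_copies_set f : #|copies_set f| = (\sum_i #|f i|)%N.
Proof.
(* As an image under the injection [Some], the set can be counted over pairs (copy, vertex). *)
have -> : copies_set f = [set Some p | p in [set p | p.2 \in f p.1]].
  apply/setP => -[[i x]|]; rewrite inE; last by apply/esym/imsetP => -[].
  by rewrite mem_imset ?inE //; apply: Some_inj.
rewrite card_imset; last exact: Some_inj.
rewrite -sum1_card big_mkcond.
under [RHS]eq_bigr => i _ do rewrite -sum1_card big_mkcond.
by rewrite pair_big /=; apply: eq_bigr => -[i x] _; rewrite inE.
Qed.

End CopySets.

(** Distinct copies are not adjacent, and $v_0$, the only vertex linking them, is absent. *)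
Lemma independent_copies_set (H : rooted_graph) k (f : {ffun 'I_k -> {set H}}) :
  independent (copies_set _ _ f : {set scale_graph k H}) =
  [forall i, independent (f i)].
Proof.
apply/independentP/forallP => [ind i | ind].
  apply/independentP => x y xf yf.
  have := ind (Some (i, x)) (Some (i, y)).
  by rewrite !inE /= eqxx; apply.
move=> [[i x]|] [[j y]|]; rewrite !inE //= => xf yf.
apply/negP => /andP[/eqP ij]; apply/negP; rewrite -ij in yf.
by have /independentP := ind i; apply.
Qed.

Lemma indep_gf_scale (H : rooted_graph) k :
  indep_gf (scale_graph k H) (fun S => scale_center k H \notin S) =
  indep_poly H ^+ k.
Proof.
rewrite indep_poly_gf /indep_gf.
rewrite (reindex_onto (copies_set k H) (set_copies k H)) /=; last first.
  by move=> S /andP[_]; apply: set_copiesK.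
(* The power becomes a product over ['I_k], which distributivity expands into a sum over $k$-tuples
   of independent sets. *)
rewrite -[in RHS](card_ord k) -prodr_const bigA_distr_big /=.
apply: eq_big => [f | f _].
  rewrite independent_copies_set copies_setK eqxx inE !andbT.
  by apply/forallP/familyP => ind i; have := ind i; rewrite /in_mem /= andbT.
by rewrite card_copies_set expr_sum.
Qed.

(** Both ratios satisfy $r^2 = (a+b)r - ab$; multiply by $r^m$ and combine linearly. *)
Lemma satisfies_recurrence_geometric2 (R : comNzRingType) (a b u v : R)
    (p : nat -> R) :
  (forall m, p m = u * a ^+ m + v * b ^+ m) ->
  satisfies_recurrence p (('X - a%:P) * ('X - b%:P)).
Proof.
move=> pE; split; first by rewrite monicMl monicXsubC.
have -> : size (('X - a%:P) * ('X - b%:P)) = 3.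
  by rewrite size_monicM ?monicXsubC -?size_poly_eq0 ?size_XsubC.
(* The order is 2, so the indices 0 and 1 are vacuous; from here [m] stands for the index minus
   2. *)
move=> [|[|m]] //= _; rewrite 2!big_ord_recr big_ord0 /= add0r !subSS subn0.
rewrite addn0 addn1 !coefM !big_ord_recr !big_ord0 /=.
rewrite !coefB !coefX !coefC /= !pE !exprS.
ring.
Qed.

Theorem theorem2p3 (G H : rooted_graph) (k : nat) :
  satisfies_recurrence
    (fun m : nat => indep_poly (attach_iter G H k m))
    (('X - (indep_poly H ^+ k)%:P) * ('X - (indep_poly (scale_graph k H))%:P)).
Proof.
apply: (satisfies_recurrence_geometric2 _ _ _
  (indep_gf G (fun S => root_of G \in S))
  (indep_gf G (fun S => root_of G \notin S))) => m.
(* [G] is generalized because [foldl] performs the first attachment on [G] itself: $m+1$ steps from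
   [G] are $m$ steps from [attach G H k]. *)
elim: m G => [|m IHm] G; first by rewrite !expr0 !mulr1 addrC -indep_gf_split.
rewrite [attach_iter _ _ _ _]/(attach_iter (attach G H k) H k m) IHm.
rewrite indep_gf_attach_in indep_gf_attach_notin indep_gf_scale.
by rewrite -!mulrA -!exprS.
Qed.
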